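(* Let $n\ge1$ and let $\lambda$ be an integer partition of $n-1$. For every $r\in[n]$ there is a bijection $\Phi_r:\mathcal{T}_{n,\lambda}\to\mathcal{T}^{(r)}_{n,\lambda}$.
   Context: $\mathcal{T}_n$ is the set of unrooted labeled trees on the vertex set $[n]=\{1,\dots,n\}$. Local orientation: each edge $\{i,j\}$ with $i<j$ of such a tree is oriented $i\to j$. The local indegree of a vertex $v$ is the number of edges oriented towards $v$, i.e. the number of neighbours of $v$ that are smaller than $v$. Global orientation: a tree rooted at $r$ has every edge oriented towards the root. The global indegree of a vertex is the number of edges oriented towards it, i.e. its number of children. The (local, respectively global) indegree sequence of a tree is the integer partition $1^{e_1}2^{e_2}\cdots$, where $e_i$ is the number of vertices of (local, respectively global) indegree $i$ for $i\ge1$. It is a partition of $n-1$. $\mathcal{T}_{n,\lambda}$ is the set of trees in $\mathcal{T}_n$ whose local indegree sequence is $\lambda$. $\mathcal{T}^{(r)}_{n,\lambda}$ is the set of labeled trees on $[n]$ rooted at $r$ whose global indegree sequence is $\lambda$. *)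

(* Defs.v *)
From mathcomp Require Import all_boot.
Set Implicit Arguments.
Unset Strict Implicit.
Unset Printing Implicit Defensive.

(* The vertex set [n] is encoded as 'I_n: the ordinal i carries the label i+1,
   so the order on labels is the order on ordinals.  A graph on [n] is given by
   its set of edges, an edge being a 2-element set of vertices. *)
Section Trees.
Variable n : nat.
Implicit Types (E : {set {set 'I_n}}) (u v r : 'I_n).

Definition simple_graph E : bool := [forall e in E, #|e| == 2].

(* On a simple graph this is irreflexive, as [set u; u] has one element. *)
Definition adj E : rel 'I_n := fun u v => [set u; v] \in E.

Definition connected E : bool := [forall u, forall v, connect (adj E) u v].

(* A cycle has pairwise distinct vertices, hence length at most n. *)
Definition acyclic E : bool :=
  [forall k : 'I_n.+1, forall c : k.-tuple 'I_n,
     (2 < k) ==> ~~ ucycleb (adj E) c].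

Definition is_tree E : bool := [&& simple_graph E, connected E & acyclic E].

(* An orientation is a relation: [o u v] means that there is an edge u -> v. *)
Definition local_orientation E : rel 'I_n := fun u v => adj E u v && (u < v).

(* u -> v when a path u, v, ..., r without repeated vertices leads from u to
   the root r through the edge {u, v}; the length bound is harmless. *)
Definition global_orientation E r : rel 'I_n := fun u v =>
  [exists k : 'I_n, exists p : k.-tuple 'I_n,
     [&& path (adj E) u (v :: p), uniq [:: u, v & p] & last v p == r]].

Definition indegree (o : rel 'I_n) v : nat := #|[set u | o u v]|.

(* Partitions are nonincreasing lists of positive parts; the part i >= 1 occurs
   here once for each vertex of indegree i. *)
Definition indegree_sequence (o : rel 'I_n) : seq nat :=
  sort geq [seq d <- [seq indegree o v | v <- enum 'I_n] | 0 < d].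

Definition local_trees (la : seq nat) : {set {set {set 'I_n}}} :=
  [set E | is_tree E & indegree_sequence (local_orientation E) == la].

Definition rooted_trees r (la : seq nat) : {set {set {set 'I_n}}} :=
  [set E | is_tree E & indegree_sequence (global_orientation E r) == la].

End Trees.

Definition is_partition (m : nat) (la : seq nat) : bool :=
  [&& sorted geq la, all (leq 1) la & sumn la == m].

(* Main.v *)
(** Root every tree at r and attach to each vertex v <> r its parent p v.  The
    global indegree sequence lists the fibre sizes of p on the non-root
    vertices, the local one those of v |-> max (v, p v), since the edge {v, p v}
    points to its larger end.  So it suffices that, for every set partition of
    the non-root vertices, as many trees have p as have v |-> max (v, p v) with
    that kernel; by Moebius inversion, that as many have it constant on blocks.
    A tree with p constant on blocks attaches each block B, of maximum m, as a
    star to a vertex c.  If c < m, replace the star by the broom that attaches m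
    to c and the rest of B to m; now max (v, p v) is constant on B, and every
    vertex of B still reaches c, so the graph still is a tree.  This is a
    bijection, the inverse attaching all of B to the parent of m. *)

Require Import Defs.
From mathcomp Require Import all_boot.

Set Implicit Arguments.
Unset Strict Implicit.
Unset Printing Implicit Defensive.

(** * Counting by fibres and Moebius inversion over supersets *)

Lemma bijective_of_card (T U : finType) :
  #|T| = #|U| -> exists f : T -> U, bijective f.
Proof.
move=> eqTU; exists (fun x => enum_val (cast_ord eqTU (enum_rank x))).
exists (fun y => enum_val (cast_ord (esym eqTU) (enum_rank y))) => x.
  by rewrite enum_valK cast_ordK enum_rankK.
by rewrite enum_valK cast_ordKV enum_rankK.
Qed.

Lemma card_fibers (T S : finType) (A : pred T) (K : T -> S) (f : pred S) :
  #|[set a in A | f (K a)]| = \sum_(P | f P) #|[set a in A | K a == P]|.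
Proof.
rewrite -sum1_card (partition_big K f) => [|a]; last by rewrite inE => /andP[].
apply: eq_bigr => P fP; rewrite -sum1_card; apply: eq_bigl => a.
by rewrite !inE -andbA; case: eqP => [->|]; rewrite ?fP // !andbF.
Qed.

(* The hypotheses are needed only for [P] a value of [K1] or [K2]: at any other
   [P] both sides vanish. *)
Lemma card_superset_inversion (T S : finType) (A : pred T)
    (K1 K2 : T -> {set S}) :
  (forall a, #|[set b in A | K1 a \subset K1 b]|
             = #|[set b in A | K1 a \subset K2 b]|) ->
  (forall a, #|[set b in A | K2 a \subset K1 b]|
             = #|[set b in A | K2 a \subset K2 b]|) ->
  forall P, #|[set a in A | K1 a == P]| = #|[set a in A | K2 a == P]|.
Proof.
(* Strict supersets of [P] have smaller complements, so by induction their terms agree and cancel,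
   leaving the terms at [P]. *)
move=> eq1 eq2 P; have [k] := ubnP #|~: P|.
elim: k P => // k IHk P ltPk.
have [exP | noP] := boolP [exists a, (K1 a == P) || (K2 a == P)]; last first.
  rewrite negb_exists in noP; move/forallP: noP => noP.
  by apply: eq_card => a; rewrite !inE; have := noP a; rewrite negb_or;
    case/andP=> /negPf-> /negPf->.
have {exP} : #|[set b in A | P \subset K1 b]| = #|[set b in A | P \subset K2 b]|.
  by case/existsP: exP => a /orP[] /eqP <-.
rewrite (card_fibers _ K1 (fun Q => P \subset Q)).
rewrite (card_fibers _ K2 (fun Q => P \subset Q)).
rewrite (bigD1 P) //= [in RHS](bigD1 P) //=.
set s1 := \sum_(_ | _) _; set s2 := \sum_(_ | _) _.
suff -> : s1 = s2 by apply: addIn.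
apply: eq_bigr => Q /andP[sPQ neQP]; apply: IHk.
apply: leq_trans (ltPk : #|~: P| <= k); apply: proper_card.
by rewrite properEneq setCS sPQ (inj_eq (@setC_inj _)) neQP.
Qed.

(** * Parent functions of trees rooted at [r] *)

Section RootedFunctions.
Variables (n : nat) (r : 'I_n).
Implicit Types (p q h : {ffun 'I_n -> 'I_n}) (u v w : 'I_n).

Definition rooted p : bool := (p r == r) && [forall v, fconnect p v r].

(** The rank is the depth: the least number of iterations of [p] that lead to [r]. *)
Lemma rooted_rank p :
  rooted p -> exists d : 'I_n -> nat, forall v, v != r -> d (p v) < d v.
Proof.
case/andP=> _ /forallP pr.
have ex v : exists k, iter k p v == r.
  by exists (findex p v r); rewrite iter_findex.
exists (fun v => ex_minn (ex v)) => v v_r.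
case: ex_minnP => k _ mink; case: ex_minnP => [[|l]]; first by rewrite (negPf v_r).
by rewrite iterSr => /mink.
Qed.

Lemma rank_rooted p (d : 'I_n -> nat) :
  p r = r -> (forall v, v != r -> d (p v) < d v) -> rooted p.
Proof.
move=> pr dp; rewrite /rooted pr eqxx; apply/forallP=> v.
have [k] := ubnP (d v); elim: k v => // k IHk v ltvk.
have [->|v_r] := eqVneq v r; first exact: connect0.
apply: connect_trans (fconnect1 p v) (IHk _ _).
exact: leq_trans (dp v v_r) ltvk.
Qed.

Lemma rooted_ind p (P : 'I_n -> Prop) :
  rooted p -> P r -> (forall v, v != r -> P (p v) -> P v) -> forall v, P v.
Proof.
case/rooted_rank=> d dp Pr Pp v; have [k] := ubnP (d v).
elim: k v => // k IHk v ltvk; have [->//|v_r] := eqVneq v r.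
exact: Pp (IHk _ (leq_trans (dp v v_r) ltvk)).
Qed.

(** Encodes a set partition of the non-roots as a set of pairs, so that inclusion of the kernel of
    [h] in that of [g] says that [g] is constant on the blocks of [h]. *)
Definition ker_on_nonroots (h : 'I_n -> 'I_n) : {set 'I_n * 'I_n} :=
  [set x | [&& x.1 != r, x.2 != r & h x.1 == h x.2]].

Definition local_head p v : 'I_n := if p v < v then v else p v.

Lemma local_headE p v : local_head p v = maxn (p v) v :> nat.
Proof.
by rewrite /local_head maxnE; case: ltnP => [/ltnW/subnKC|/eqP->]; rewrite ?addn0.
Qed.

(** * Turning stars into brooms and back *)

Section BlockMax.
Variable m : 'I_n -> 'I_n.
Hypotheses (m_root : m r = r) (m_idem : forall v, m (m v) = m v).
Hypotheses (le_m : forall v, v <= m v).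

(* [m v] stands for the maximum of the block of [v].  If [p] is constant on
   blocks and comes from a tree, then [p v = m v] is impossible on non-roots
   (it gives a loop at [m v]), so the value chosen in that case is immaterial. *)
Definition star_to_broom p : {ffun 'I_n -> 'I_n} :=
  [ffun v => if (m v < p v) || (v == m v) then p v else m v].
Definition broom_to_star q : {ffun 'I_n -> 'I_n} := [ffun v => q (m v)].

(** If [v] is not [m v], the common head is at least [m v], hence above [v], so it must be [q v];
    the last two cases say which end of the edge at [m v] it is. *)
Lemma broom_cases q v : local_head q v = local_head q (m v) ->
  [\/ v = m v, m v < q (m v) /\ q v = q (m v)
    | q (m v) <= m v /\ q v = m v].
Proof.
move/(congr1 val) => /=; rewrite !local_headE => eqh.
have [e|ne] := eqVneq v (m v); first by constructor 1.
have lt_v : v < m v by rewrite ltn_neqAle ne le_m.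
case: (ltnP (m v) (q (m v))) => [lt|le].
  constructor 2; split=> //; apply: val_inj => /=.
  move: eqh; rewrite (maxn_idPl (ltnW lt)).
  case: (leqP v (q v)) => // _ e.
  by move: lt_v; rewrite e ltnNge (ltnW lt).
constructor 3; split=> //; apply: val_inj => /=.
move: eqh; rewrite (maxn_idPr le).
case: (leqP v (q v)) => // _ e.
by move: lt_v; rewrite e ltnn.
Qed.

Lemma star_to_broom_max p v :
  (forall v, p (m v) = p v) -> star_to_broom p (m v) = p v.
Proof. by move=> pm; rewrite ffunE m_idem eqxx orbT. Qed.

(** Each vertex still reaches its old parent [p v], directly or through [m v], so induction on the
    depth in [p] applies. *)
Lemma star_to_broom_rooted p :
  (forall v, p (m v) = p v) -> rooted p -> rooted (star_to_broom p).
Proof.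
move=> pm rp; have [d dP] := rooted_rank rp; have /andP[/eqP pr _] := rp.
rewrite /rooted ffunE m_root eqxx orbT pr eqxx /=; apply/forallP=> v.
have [k] := ubnP (d v); elim: k v => // k IHk v ltvk.
have [->|v_r] := eqVneq v r; first exact: connect0.
have {}IHk : fconnect (star_to_broom p) (p v) r.
  by apply: IHk; apply: leq_trans (dP v v_r) ltvk.
apply: connect_trans IHk; have := fconnect1 (star_to_broom p) v.
rewrite ffunE; case: ifP => // _ /connect_trans; apply.
by rewrite -(star_to_broom_max v pm) fconnect1.
Qed.

(** The new parent [q (m v)] is [q v] or [q (q v)], so the depth in [q] still decreases. *)
Lemma broom_to_star_rooted q :
  (forall v, v != r -> local_head q v = local_head q (m v)) ->
  rooted q -> rooted (broom_to_star q).
Proof.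
move=> hq rq; have [d dP] := rooted_rank rq; have /andP[/eqP qr _] := rq.
rewrite /rooted ffunE m_root qr eqxx /=; apply/forallP=> v.
have [k] := ubnP (d v); elim: k v => // k IHk v ltvk.
have [->|v_r] := eqVneq v r; first exact: connect0.
apply: connect_trans (fconnect1 _ v) _; rewrite ffunE; apply: IHk.
apply: leq_trans (ltvk : d v <= k); have := dP v v_r.
case: (broom_cases (hq v v_r)) => [<- //|[_ <-] //|[_ qv]].
(* The hypotheses on [m] allow [m v] to be the root, where [d] need not decrease. *)
rewrite qv; have [mr|/dP lt] := eqVneq (m v) r; first by rewrite mr qr.
exact: ltn_trans.
Qed.

(** Both heads are the larger of [m v] and [p v]. *)
Lemma star_to_broom_head p v : (forall v, p (m v) = p v) ->
  local_head (star_to_broom p) v = local_head (star_to_broom p) (m v).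
Proof.
move=> pm; apply: val_inj => /=; rewrite !local_headE star_to_broom_max // ffunE.
have [lt|le] /= := ltnP (m v) (p v).
  exact/maxn_idPl/ltnW/(leq_ltn_trans (le_m v)).
by case: eqP => [e|_]; [rewrite -e in le *; apply/maxn_idPr | apply/maxn_idPl].
Qed.

Lemma star_to_broomK p :
  (forall v, p (m v) = p v) -> broom_to_star (star_to_broom p) = p.
Proof. by move=> pm; apply/ffunP=> v; rewrite ffunE star_to_broom_max. Qed.

Lemma broom_to_starK q :
  (forall v, v != r -> local_head q v = local_head q (m v)) ->
  star_to_broom (broom_to_star q) = q.
Proof.
move=> hq; apply/ffunP=> v; rewrite !ffunE.
have [->|/hq] := eqVneq v r; first by rewrite m_root eqxx orbT.
case/broom_cases=> [<-|[-> ->] //|[le qv]]; first by rewrite eqxx orbT.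
by rewrite ltnNge le; case: eqP => // <-.
Qed.

End BlockMax.

(** The root lies in no block; it is fixed so as to meet the hypothesis [m_root]. *)
Definition block_max (h : 'I_n -> 'I_n) v : 'I_n :=
  if v == r then r else [arg max_(u > v | (u != r) && (h u == h v)) (u : nat)].

Lemma block_maxP (h : 'I_n -> 'I_n) v : v != r ->
  [/\ block_max h v != r, h (block_max h v) = h v
    & forall u, u != r -> h u = h v -> u <= block_max h v].
Proof.
move=> v_r; rewrite /block_max (negPf v_r).
case: arg_maxnP => [|w /andP[w_r /eqP hw] maxw]; first by rewrite v_r eqxx.
by split=> // u u_r hu; apply: maxw; rewrite u_r hu /=.
Qed.

Lemma block_max_root (h : 'I_n -> 'I_n) : block_max h r = r.
Proof. by rewrite /block_max eqxx. Qed.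

Lemma leq_block_max (h : 'I_n -> 'I_n) v : v <= block_max h v.
Proof.
have [->|v_r] := eqVneq v r; first by rewrite block_max_root.
by have [_ _] := block_maxP h v_r; apply.
Qed.

Lemma eq_block_max (h : 'I_n -> 'I_n) u v :
  u != r -> v != r -> h u = h v -> block_max h u = block_max h v.
Proof.
move=> u_r v_r huv; apply/val_inj/eqP; rewrite /= eqn_leq.
have [mu_r hmu maxu] := block_maxP h u_r.
have [mv_r hmv maxv] := block_maxP h v_r.
by rewrite maxu ?maxv // ?hmu ?hmv.
Qed.

Lemma block_max_idem (h : 'I_n -> 'I_n) v :
  block_max h (block_max h v) = block_max h v.
Proof.
have [->|v_r] := eqVneq v r; first by rewrite !block_max_root.
by have [mv_r hmv _] := block_maxP h v_r; apply: eq_block_max.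
Qed.

(** Vertices of one block share its maximum, so comparing each with that maximum suffices. *)
Lemma sub_ker_block_max (h g : 'I_n -> 'I_n) :
  reflect (forall v, v != r -> g v = g (block_max h v))
          (ker_on_nonroots h \subset ker_on_nonroots g).
Proof.
apply: (iffP subsetP) => [sub v v_r|gm [u v]].
  have [mv_r hmv _] := block_maxP h v_r.
  by have := sub (v, block_max h v); rewrite !inE /= v_r mv_r hmv eqxx => /(_ isT) /eqP.
rewrite !inE /= => /and3P[u_r v_r /eqP huv].
by rewrite u_r v_r /= (gm u) // (gm v) // (eq_block_max u_r v_r huv).
Qed.

Lemma card_rooted_superker (h : 'I_n -> 'I_n) :
  #|[set p in rooted | ker_on_nonroots h \subset ker_on_nonroots p]|
  = #|[set p in rooted |
       ker_on_nonroots h \subset ker_on_nonroots (local_head p)]|.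
Proof.
pose m := block_max h.
have mr : m r = r := block_max_root h.
have mI : forall v, m (m v) = m v := block_max_idem h.
have lem : forall v, v <= m v := leq_block_max h.
have pmP p : ker_on_nonroots h \subset ker_on_nonroots p ->
    forall v, p (m v) = p v.
  move/sub_ker_block_max=> pm v; have [->|/pm//] := eqVneq v r.
  by rewrite mr.
rewrite -(@card_in_imset _ _ (star_to_broom m)); last first.
  move=> p q; rewrite !inE => /andP[_ /pmP pm] /andP[_ /pmP qm] e.
  by rewrite -(star_to_broomK mI pm) e star_to_broomK.
apply: eq_card => q; rewrite !inE; apply/imsetP/andP => [[p]|[rq /sub_ker_block_max hq]].
  rewrite inE => /andP[rp /pmP pm] ->; split; first exact: star_to_broom_rooted.
  by apply/sub_ker_block_max => v _; apply: star_to_broom_head.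
exists (broom_to_star m q); last by rewrite broom_to_starK.
rewrite inE; apply/andP; split; first exact: broom_to_star_rooted.
by apply/sub_ker_block_max => v _; rewrite !ffunE mI.
Qed.

(** Moebius inversion of the preceding count, taken with [h] equal to [p] or to its local head. *)
Lemma card_rooted_ker P :
  #|[set p in rooted | ker_on_nonroots p == P]|
  = #|[set p in rooted | ker_on_nonroots (local_head p) == P]|.
Proof.
apply: (@card_superset_inversion _ _ rooted
  (fun p : {ffun 'I_n -> 'I_n} => ker_on_nonroots p)
  (fun p => ker_on_nonroots (local_head p))) => p;
  exact: card_rooted_superker.
Qed.

(** When [K] is a kernel its rows are the blocks; collecting them in a set keeps each block once. *)
Definition block_sizes (K : {set 'I_n * 'I_n}) : seq nat :=
  sort geq [seq #|B| | B : {set 'I_n} <-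
    enum [set [set y | (x, y) \in K] | x in [set~ r]]].

(** Vertices of positive indegree correspond to the nonempty fibres of [h] on the non-roots, which
    are the blocks of its kernel. *)
Lemma indegree_sequence_ker (o : rel 'I_n) (h : 'I_n -> 'I_n) :
  (forall v, indegree o v = #|[set u | u != r & h u == v]|) ->
  indegree_sequence o = block_sizes (ker_on_nonroots h).
Proof.
move=> oh; rewrite /indegree_sequence /block_sizes.
have geq_total : total geq by move=> a b; apply: leq_total.
have geq_trans : transitive geq by move=> a b c /= ba cb; apply: leq_trans cb ba.
have geq_anti : antisymmetric geq by move=> a b /= ?; apply/eqP; rewrite eqn_leq andbC.
apply/perm_sortP => //; rewrite filter_map.
pose c v := [set u | u != r & h u == v].
rewrite (eq_map (g := (fun B : {set 'I_n} => #|B|) \o c)) // map_comp.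
apply: perm_map; apply: uniq_perm.
- rewrite map_inj_in_uniq ?(filter_uniq _ (enum_uniq _)) // => v w.
  rewrite mem_filter /= oh card_gt0 => /andP[/set0Pn[u uv] _] _ e.
  have : u \in c w by rewrite -e.
  by move: uv; rewrite !inE => /andP[_ /eqP <-] /andP[_ /eqP].
- exact: enum_uniq.
move=> B; rewrite mem_enum; apply/mapP/imsetP => [[v]|[x]].
  rewrite mem_filter /= oh card_gt0 => /andP[/set0Pn[u]]; rewrite inE.
  case/andP=> u_r /eqP hu _ ->; exists u; rewrite ?inE //.
  by apply/setP=> y; rewrite !inE /= u_r hu (eq_sym v).
rewrite !inE => x_r ->; exists (h x).
  by rewrite mem_filter mem_enum andbT /= oh card_gt0; apply/set0Pn; exists x;
    rewrite inE x_r /=.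
by apply/setP=> y; rewrite !inE /= x_r (eq_sym (h x)).
Qed.

End RootedFunctions.

(** * Correspondence between trees and rooted parent functions *)

Lemma eq_set2 (T : finType) (a b c d : T) :
  [set a; b] = [set c; d] -> (a = c /\ b = d) \/ (a = d /\ b = c).
Proof.
move/setP=> e; move: (e a) (e b) (e c) (e d); rewrite !inE !eqxx ?orbT.
move/esym/pred2P=> ac /esym/pred2P bc /pred2P ca /pred2P da.
by case: ac bc ca da => -> [] -> [] ? [] ?; subst; auto.
Qed.

Section TreeOfFunction.
Variables (n : nat) (r : 'I_n).
Implicit Types (p q : {ffun 'I_n -> 'I_n}) (u v w : 'I_n).
Implicit Types (E : {set {set 'I_n}}).

Definition edges_of p : {set {set 'I_n}} := [set [set v; p v] | v in [set~ r]].

Lemma adj_sym E : symmetric (adj E).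
Proof. by move=> u v; rewrite /adj setUC. Qed.

Lemma adj_edges_of p u v :
  adj (edges_of p) u v = ((u != r) && (p u == v)) || ((v != r) && (p v == u)).
Proof.
apply/imsetP/orP => [[w]|].
  by rewrite !inE => w_r /eq_set2[] [-> ->]; rewrite w_r eqxx; [left | right].
case=> /andP[w_r /eqP <-]; first by exists u; rewrite ?inE.
by exists v; rewrite ?inE // setUC.
Qed.

Lemma rooted_neq p v : rooted r p -> v != r -> v != p v.
Proof.
move/rooted_rank=> [d dp] /dp; apply: contraTneq => <-.
by rewrite ltnn.
Qed.

Lemma edges_of_connected p : rooted r p -> connected (edges_of p).
Proof.
move=> rp; have cr : forall v, connect (adj (edges_of p)) v r.
  apply: (rooted_ind rp) => [|v v_r]; first exact: connect0.
  by apply: connect_trans; apply: connect1; rewrite adj_edges_of v_r eqxx.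
apply/forallP=> u; apply/forallP=> v; apply: connect_trans (cr u) _.
by rewrite (sym_connect_sym (adj_sym _)) cr.
Qed.

Lemma edges_of_acyclic p : rooted r p -> acyclic (edges_of p).
Proof.
move=> rp; apply/forallP=> k; apply/forallP=> c; apply/implyP=> lt2k.
apply/negP=> /andP[cyc uniqc]; have [d dp] := rooted_rank rp.
(* The parent of a deepest vertex [v] of the cycle would be both neighbours of
   [v] on it. *)
have szc : size c = k by rewrite size_tuple.
have [x0 cx0] : exists x0, x0 \in tval c.
  by case: (tval c) szc => [e|x s _]; [move: lt2k; rewrite -e | exists x; exact: mem_head].
case: (@arg_maxnP _ x0 (mem (val c)) d cx0) => v /= cv maxv.
have [i s rots] := rot_to cv.
have {}cyc : cycle (adj (edges_of p)) (v :: s) by rewrite -rots rot_cycle.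
have {}uniqc : uniq (v :: s) by rewrite -rots rot_uniq.
have szs : size (v :: s) = k by rewrite -rots size_rot.
have parent w : w \in s -> adj (edges_of p) v w -> p v = w.
  move=> sw; rewrite adj_edges_of => /orP[] /andP[w_r /eqP //] pw.
  have /maxv : w \in val c by rewrite -(mem_rot i) rots inE sw orbT.
  by rewrite leqNgt -pw dp.
case: s cyc uniqc szs parent {rots} => [|a s] /=; first by move=> _ _ e; move: lt2k; rewrite -e.
rewrite rcons_path => /and3P[va _ bv] /and3P[_ a_s _] szs parent.
have pa := parent a (mem_head _ _) va.
have pb : p v = last a s by apply: parent; rewrite ?mem_last // adj_sym.
case: s a_s szs pb {bv parent} => [|b s] a_s szs pb; first by move: lt2k; rewrite -szs.
by case/negP: a_s; rewrite -pa pb /= mem_last.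
Qed.

Lemma edges_of_tree p : rooted r p -> is_tree (edges_of p).
Proof.
move=> rp; rewrite /is_tree edges_of_connected // edges_of_acyclic // !andbT.
apply/forallP=> e; apply/implyP=> /imsetP[v]; rewrite !inE => v_r ->.
by rewrite cards2 (rooted_neq rp).
Qed.

(** Induction from the root end: the parent of [v] is the next vertex of the path, so it is not [u],
    and the edge between [u] and [v] must come from [u]. *)
Lemma path_to_root p u v s : p r = r ->
  path (adj (edges_of p)) u (v :: s) -> uniq [:: u, v & s] -> last v s = r ->
  u != r /\ p u = v.
Proof.
move=> pr; elim: s u v => [|w s IHs] u v /=.
  rewrite andbT adj_edges_of => uv; rewrite inE andbT => u_v vr.
  move: uv; rewrite vr eqxx /= orbF in u_v *; rewrite -vr.
  by case/andP=> -> /eqP.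
case/andP=> uv vws /andP[u_vws uniqs] lastr.
have [v_r pv] := IHs v w vws uniqs lastr; split.
  by apply: contraNneq u_vws => ->; rewrite -lastr inE mem_last orbT.
move: uv; rewrite adj_edges_of => /orP[] /andP[_ /eqP //].
by rewrite pv => wu; rewrite wu !inE eqxx !orbT in u_vws.
Qed.

Lemma global_orientation_edges_of p u v : rooted r p ->
  global_orientation (edges_of p) r u v = (u != r) && (p u == v).
Proof.
move=> rp; have /andP[/eqP pr _] := rp.
apply/existsP/andP => [[k /existsP[s /and3P[pus uniqs /eqP lastr]]]|[u_r /eqP puv]].
  by have [-> ->] := path_to_root pr pus uniqs lastr.
have /forallP/(_ u)/forallP/(_ r)/connectP[s0] := edges_of_connected rp.
case/shortenP=> -[|w s] pus uniqs _ /= lastr; first by rewrite lastr eqxx in u_r.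
have [_ puw] := path_to_root pr pus uniqs (esym lastr).
(* The path has [size s + 2] distinct vertices, so [s] meets the length bound in
   [global_orientation]. *)
have szs : size s < n.
  have := card_uniqP uniqs; have := max_card (mem [:: u, w & s]).
  by rewrite card_ord => + e; rewrite e => /ltnW.
exists (Ordinal szs); apply/existsP; exists (in_tuple s).
by rewrite -puv puw; apply/and3P; split=> //; rewrite -lastr.
Qed.

(** The orientation towards [r] depends on the edges alone and gives back every parent. *)
Lemma edges_of_inj : {in [set p | rooted r p] &, injective edges_of}.
Proof.
move=> p q; rewrite !inE => rp rq e; apply/ffunP=> v.
have [->|v_r] := eqVneq v r.
  by have /andP[/eqP-> _] := rp; have /andP[/eqP-> _] := rq.
have := global_orientation_edges_of v (p v) rp.
by rewrite e global_orientation_edges_of // v_r eqxx => /eqP.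
Qed.

Lemma tree_edges_of E :
  is_tree E -> exists2 p, rooted r p & E = edges_of p.
Proof.
case/and3P=> simpE connE acycE.
have ex v : exists k, [exists s : k.-tuple 'I_n, path (adj E) v s && (last v s == r)].
  have /forallP/(_ v)/forallP/(_ r)/connectP[s vs lastr] := connE.
  by exists (size s); apply/existsP; exists (in_tuple s); rewrite vs -lastr /=.
(* This is the distance to [r] in [E]; the parent of [v] will be any neighbour closer to [r]. *)
pose d v := ex_minn (ex v).
have closer v : v != r -> exists u, adj E v u && (d u < d v).
  move=> v_r; rewrite {2}/d; case: ex_minnP => k /existsP[[s /= /eqP szs]].
  case/andP; case: s szs => [|u s] /= szs; first by rewrite (negPf v_r).
  case/andP=> vu us lastr _; exists u; rewrite vu /= /d.
  case: ex_minnP => l _ minl; rewrite -szs ltnS minl //.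
  by apply/existsP; exists (in_tuple s); rewrite us.
pose p := [ffun v => if v == r then r else odflt r [pick u | adj E v u && (d u < d v)]].
have pP v : v != r -> adj E v (p v) && (d (p v) < d v).
  move=> v_r; rewrite ffunE (negPf v_r); case: pickP => //= none.
  by have [u] := closer v v_r; rewrite none.
have pr : p r = r by rewrite ffunE eqxx.
have rp : rooted r p by apply: (rank_rooted (d := d)) => // v /pP/andP[].
exists p => //; apply/eqP; rewrite eqEsubset; apply/andP; split; last first.
  by apply/subsetP=> e /imsetP[v]; rewrite !inE => /pP/andP[vp _] ->.
apply/subsetP=> e eE.
have /forallP/(_ e)/implyP/(_ eE)/cards2P[u [v [u_v eqe]]] := simpE.
(* If the edge did not come from [p], a path from [u] to [v] along edges of [p] would have length at
   least 2, and the edge would close it to a cycle in [E]. *)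
rewrite eqe in eE *; apply: contraTT isT => notE.
have subE : subrel (adj (edges_of p)) (adj E).
  move=> a b; rewrite adj_edges_of => /orP[] /andP[/pP/andP[+ _] /eqP <-] //.
  by rewrite adj_sym.
have /forallP/(_ u)/forallP/(_ v)/connectP[s0] := edges_of_connected rp.
case/shortenP=> -[|w s] us uniqs _ /= lastv; first by rewrite lastv eqxx in u_v.
case: s us uniqs lastv => [|x s] us uniqs lastv.
  by case/negP: notE; rewrite lastv /= in us *; case/andP: us.
have sz : size [:: u, w, x & s] < n.+1.
  by rewrite ltnS -(card_uniqP uniqs) (leq_trans (max_card _)) ?card_ord.
have /forallP/(_ (Ordinal sz))/forallP/(_ (in_tuple [:: u, w, x & s])) := acycE.
move=> /= /negP[]; rewrite /ucycleb uniqs andbT /cycle rcons_path.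
by rewrite (sub_path subE us) /= in lastv *; rewrite -lastv adj_sym.
Qed.

Lemma indegree_global p v : rooted r p ->
  indegree (global_orientation (edges_of p) r) v = #|[set u | u != r & p u == v]|.
Proof.
by move=> rp; apply: eq_card => u; rewrite !inE global_orientation_edges_of.
Qed.

(** Sending [w] to the smaller end of its edge matches the non-roots with head [v] to the smaller
    neighbours of [v]. *)
Lemma indegree_local p v : rooted r p ->
  indegree (local_orientation (edges_of p)) v
  = #|[set w | w != r & local_head p w == v]|.
Proof.
move=> rp; pose tail w := if p w < w then p w else w.
have edgeE w : [set w; p w] = [set tail w; local_head p w].
  by rewrite /tail /local_head; case: ifP; rewrite // setUC.
(* Two distinct non-roots with the same edge would be parents of each other, against the rank. *)
have edge_inj w1 w2 : w1 != r -> w2 != r ->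
    [set w1; p w1] = [set w2; p w2] -> w1 = w2.
  move=> w1_r w2_r /eq_set2[[] //|[e1 e2]]; have [d dp] := rooted_rank rp.
  have := dp _ w1_r; rewrite e2 e1 => lt1.
  by have := ltn_trans lt1 (dp _ w2_r); rewrite ltnn.
rewrite -(@card_in_imset _ _ tail); last first.
  move=> w1 w2; rewrite !inE => /andP[w1_r /eqP h1] /andP[w2_r /eqP h2] e.
  by apply: edge_inj; rewrite // !edgeE h1 h2 e.
apply: eq_card => u; rewrite !inE /local_orientation adj_edges_of.
apply/andP/imsetP => [[/orP[] /andP[w_r /eqP <-] lt]|[w]].
- have pu : (p u < u) = false by rewrite ltnNge (ltnW lt).
  by exists u; rewrite ?inE /tail /local_head pu ?w_r /=.
- by exists v; rewrite ?inE /tail /local_head lt ?w_r /=.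
rewrite inE => /andP[w_r /eqP <-] ->; rewrite /tail /local_head.
case: ltnP => [lt|le]; first by rewrite w_r eqxx orbT.
by rewrite w_r eqxx ltn_neqAle le (rooted_neq rp).
Qed.

Lemma card_trees (K : {ffun 'I_n -> 'I_n} -> {set 'I_n * 'I_n})
    (o : {set {set 'I_n}} -> rel 'I_n) (la : seq nat) :
  (forall p, rooted r p -> indegree_sequence (o (edges_of p)) = block_sizes r (K p)) ->
  #|[set E | is_tree E & indegree_sequence (o E) == la]|
  = #|[set p in rooted r | block_sizes r (K p) == la]|.
Proof.
move=> oK; rewrite -(@card_in_imset _ _ edges_of); last first.
  move=> p q; rewrite !inE => /andP[rp _] /andP[rq _].
  by apply: edges_of_inj; rewrite inE.
apply: eq_card => E; rewrite inE; apply/andP/imsetP => [[/tree_edges_of[p rp ->]]|[p]].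
  by rewrite oK // => ep; exists p; rewrite // inE; apply/andP.
by rewrite inE => /andP[rp ep] ->; rewrite edges_of_tree // oK.
Qed.

(** Both indegree sequences are block sizes of kernels, and each kernel occurs equally often on the
    two sides. *)
Lemma card_local_rooted_trees (la : seq nat) :
  #|local_trees n la| = #|rooted_trees r la|.
Proof.
rewrite (@card_trees (fun p => ker_on_nonroots r (local_head p)) (@local_orientation n)).
  rewrite (@card_trees (fun p => ker_on_nonroots r p)
             (fun E => @global_orientation n E r)).
    have sizes K := @card_fibers _ _ (rooted r) K (fun P => block_sizes r P == la).
    rewrite (sizes (fun p => ker_on_nonroots r (local_head p))).
    rewrite (sizes (fun p : {ffun 'I_n -> 'I_n} => ker_on_nonroots r p)).
    by apply: eq_bigr => P _; rewrite card_rooted_ker.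
  by move=> p rp; apply: indegree_sequence_ker => v; apply: indegree_global.
by move=> p rp; apply: indegree_sequence_ker => v; apply: indegree_local.
Qed.

End TreeOfFunction.

Theorem theorem1p3 (n : nat) (hn : 1 <= n) (la : seq nat)
    (hla : is_partition n.-1 la) (r : 'I_n) :
  exists Phi : {E : {set {set 'I_n}} | E \in local_trees n la} ->
               {E : {set {set 'I_n}} | E \in rooted_trees r la},
    bijective Phi.
Proof.
by apply: bijective_of_card; rewrite !card_sig (card_local_rooted_trees r la).
Qed.
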